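(* Let $\mathcal{M}$ be a first-order structure with universe $\mathbb{Z}$ (in any language). Suppose $\mathcal{M}$ is an expansion of $(\mathbb{Z},+,0)$ and a reduct of $(\mathbb{Z},+,<,0)$. Then $\mathcal{M}$ is interdefinable with either $(\mathbb{Z},+,0)$ or $(\mathbb{Z},+,<,0)$.
   Context: Definability always means first-order definability with parameters from the underlying universe. Let $\mathcal{M}_1,\mathcal{M}_2$ be first-order structures with the same universe $M$, possibly in different languages. $\mathcal{M}_1$ is a reduct of $\mathcal{M}_2$ (equivalently, $\mathcal{M}_2$ is an expansion of $\mathcal{M}_1$) if, for all $n>0$, every subset of $M^n$ definable in $\mathcal{M}_1$ is definable in $\mathcal{M}_2$. $\mathcal{M}_1$ and $\mathcal{M}_2$ are interdefinable if each is a reduct of the other. *)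

(* Defs.v *)
From mathcomp Require Import all_boot all_order all_algebra.

Set Implicit Arguments.
Unset Strict Implicit.
Unset Printing Implicit Defensive.

(* Constants are function symbols of arity 0. *)
Record language := Language {
  fun_symbol : Type;
  fun_arity : fun_symbol -> nat;
  rel_symbol : Type;
  rel_arity : rel_symbol -> nat
}.

Record structure (L : language) (M : Type) := Structure {
  fun_interp : forall f : fun_symbol L, (fun_arity f).-tuple M -> M;
  rel_interp : forall r : rel_symbol L, (rel_arity r).-tuple M -> Prop
}.

(* [term L n] and [formula L n] have their free variables among x_0, ..., x_{n-1}. *)
Inductive term (L : language) (n : nat) : Type :=
  | Var (i : 'I_n)
  | App (f : fun_symbol L) (ts : 'I_(fun_arity f) -> term L n).

(* [Ex] binds the variable x_0 of its body and shifts the others by one.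
   The other connectives and the universal quantifier are expressed classically
   from negation, conjunction and [Ex]. *)
Inductive formula (L : language) : nat -> Type :=
  | Eq n (s t : term L n) : formula L n
  | Rel n (r : rel_symbol L) (ts : 'I_(rel_arity r) -> term L n) : formula L n
  | Neg n (psi : formula L n) : formula L n
  | And n (psi chi : formula L n) : formula L n
  | Ex n (psi : formula L n.+1) : formula L n.

Fixpoint eval (L : language) (M : Type) (S : structure L M) (n : nat)
    (e : n.-tuple M) (t : term L n) : M :=
  match t with
  | Var i => tnth e i
  | App f ts => fun_interp S (f := f) [tuple eval S e (ts i) | i < fun_arity f]
  end.

Fixpoint sat (L : language) (M : Type) (S : structure L M) (n : nat)
    (phi : formula L n) : n.-tuple M -> Prop :=
  match phi with
  | Eq _ s t => fun e => eval S e s = eval S e t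
  | Rel _ r ts =>
      fun e => rel_interp S (r := r) [tuple eval S e (ts i) | i < rel_arity r]
  | Neg _ psi => fun e => ~ sat S psi e
  | And _ psi chi => fun e => sat S psi e /\ sat S chi e
  | Ex _ psi => fun e => exists x : M, sat S psi [tuple of x :: e]
  end.

(* [b] is the tuple of parameters. *)
Definition definable (L : language) (M : Type) (S : structure L M) (n : nat)
    (X : n.-tuple M -> Prop) : Prop :=
  exists (m : nat) (phi : formula L (n + m)) (b : m.-tuple M),
    forall a : n.-tuple M, X a <-> sat S phi [tuple of a ++ b].

Definition reduct (L1 L2 : language) (M : Type)
    (S1 : structure L1 M) (S2 : structure L2 M) : Prop :=
  forall (n : nat) (X : n.-tuple M -> Prop),
    0 < n -> definable S1 X -> definable S2 X.

Definition expansion (L1 L2 : language) (M : Type)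
    (S1 : structure L1 M) (S2 : structure L2 M) : Prop := reduct S2 S1.

Definition interdefinable (L1 L2 : language) (M : Type)
    (S1 : structure L1 M) (S2 : structure L2 M) : Prop :=
  reduct S1 S2 /\ reduct S2 S1.

Inductive group_fun := Plus | Zero.

Definition group_fun_arity (f : group_fun) : nat :=
  match f with Plus => 2 | Zero => 0 end.

Inductive order_rel := Less.

Definition order_rel_arity (r : order_rel) : nat := 2.

Definition group_language : language :=
  @Language group_fun group_fun_arity void (fun r => match r with end).

Definition ordered_group_language : language :=
  @Language group_fun group_fun_arity order_rel order_rel_arity.

Definition int_fun (f : group_fun) : (group_fun_arity f).-tuple int -> int :=
  match f with
  | Plus => fun v : 2.-tuple int => (tnth v ord0 + tnth v ord_max)%R
  | Zero => fun _ => 0%R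
  end.

Definition int_rel (r : order_rel) (v : (order_rel_arity r).-tuple int) : Prop :=
  (tnth v ord0 < tnth v ord_max)%R.

(* (Z, +, 0) *)
Definition int_group : structure group_language int :=
  @Structure group_language int int_fun (fun r => match r with end).

(* (Z, +, <, 0) *)
Definition int_ordered_group : structure ordered_group_language int :=
  @Structure ordered_group_language int int_fun int_rel.

(* Main.v *)
Require Import Defs.
From mathcomp Require Import all_boot all_order all_algebra.
From mathcomp Require Import zify.
From Stdlib Require Import Classical FunctionalExtensionality IndefiniteDescription.

Set Implicit Arguments.
Unset Strict Implicit.
Unset Printing Implicit Defensive.

Import Order.TTheory GRing.Theory Num.Theory.
Local Open Scope ring_scope.

(** Let S be intermediate between (Z, +, 0) and (Z, +, <, 0), and suppose that the
    order is not definable in S.  Every S-definable set is Presburger definable, and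
    it has to be shown that it is already definable in the group.

    Two facts are used throughout.  First, quantifier elimination
    ([Def_ordered_group_presburger], by Cooper's method): over a point a, the fibre of
    a Presburger set is, up to rescaling, periodic with a fixed period between
    consecutive values t(a) of finitely many affine forms t ([presburger_fibers]).
    Secondly, in dimension 1: the two ends of an S-definable subset of Z agree, since
    otherwise a residue class of it would be a half-line up to finitely many points,
    and a half-line defines the order ([ray_order]).  So unary S-definable sets are
    periodic off a finite set ([unary_periodic]).

    The proof is by induction on the number of coordinates
    ([Def_group_of_Def]).  Let X be an S-definable subset of Z x Z^n.  As the ends of
    each fibre agree, the part of X that is periodic in the fibre direction can be
    subtracted definably, and the induction hypothesis applies to it; there remains a
    set whose fibres are finite ([Def_group_fibered]).  If all points of the fibres
    stay within a bounded distance of the values t(a), then X is a finite union of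
    pieces of graphs of affine functions, over sets to which the induction hypothesis
    applies ([Def_group_near_lines]).

    The distance is in fact always bounded ([fibers_near_lines]).  If it were not, a
    Dickson-style pumping argument ([presburger_pump]) would give an affine line in Z^n
    over which it is unbounded, that is, a set F in the plane with finite fibres,
    periodic between finitely many lines, with points arbitrarily far from these lines.
    Its intersection with every line is S-definable and unary, so that it looks the
    same at +oo and at -oo.  This is impossible ([planar_false]): at +oo take the
    sector of F that lies above a line of least possible slope.  Following a parallel
    of that line to -oo one meets the sector on the other side of the plane; it is
    bounded above by a line of smaller slope, and following a parallel of the latter
    back to +oo one finds a sector of F above a line of still smaller slope. *)

(** * Definable predicates on environments *)

Fixpoint ren_term L n n' (r : 'I_n -> 'I_n') (t : term L n) : term L n' :=
  match t with
  | Var i => Var L (r i)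
  | App f ts => App (fun i => ren_term r (ts i))
  end.

(** Renaming under a binder: the bound variable is [ord0]. *)
Definition ren_up n n' (r : 'I_n -> 'I_n') (i : 'I_n.+1) : 'I_n'.+1 :=
  if unlift ord0 i is Some j then lift ord0 (r j) else ord0.

Fixpoint ren L n (phi : formula L n) : forall n', ('I_n -> 'I_n') -> formula L n' :=
  match phi in formula _ n return forall n', ('I_n -> 'I_n') -> formula L n' with
  | Eq _ s t => fun _ r => Eq (ren_term r s) (ren_term r t)
  | Rel _ q ts => fun _ r => Rel (fun i => ren_term r (ts i))
  | Neg _ psi => fun _ r => Neg (ren psi r)
  | And _ psi chi => fun _ r => And (ren psi r) (ren chi r)
  | Ex _ psi => fun _ r => Ex (ren psi (ren_up r))
  end.

Section Renaming.
Variables (L : language) (M : Type) (S : structure L M).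

Lemma eval_ren n n' (r : 'I_n -> 'I_n') (t : term L n) (e : n'.-tuple M) :
  eval S e (ren_term r t) = eval S [tuple tnth e (r i) | i < n] t.
Proof.
elim: t => [i|f ts IH] /=; first by rewrite tnth_mktuple.
by congr fun_interp; apply: eq_from_tnth => i; rewrite !tnth_mktuple IH.
Qed.

Lemma cons_mktuple n (x : M) (v : 'I_n -> M) (w : 'I_n.+1 -> M) :
  w ord0 = x -> (forall i, w (lift ord0 i) = v i) ->
  [tuple of x :: [tuple v i | i < n]] = [tuple w i | i < n.+1].
Proof.
move=> w0 wS; apply: eq_from_tnth => i; rewrite tnth_mktuple.
case: (unliftP ord0 i) => [j|] ->; last by rewrite tnth0 w0.
by rewrite tnthS tnth_mktuple wS.
Qed.

Lemma sat_ren n (phi : formula L n) n' (r : 'I_n -> 'I_n') (e : n'.-tuple M) :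
  sat S (ren phi r) e <-> sat S phi [tuple tnth e (r i) | i < n].
Proof.
elim: phi n' r e => {n} [n s t|n q ts|n psi IH|n psi IH chi IH'|n psi IH] n' r e /=.
- by rewrite !eval_ren.
- suff -> : [tuple eval S e (ren_term r (ts i)) | i < rel_arity q] =
    [tuple eval S [tuple tnth e (r i) | i < n] (ts i) | i < rel_arity q] by [].
  by apply: eq_from_tnth => i; rewrite !tnth_mktuple eval_ren.
- by rewrite IH.
- by rewrite IH IH'.
- suff E x : [tuple of x :: [tuple tnth e (r i) | i < n]] =
      [tuple tnth [tuple of x :: e] (ren_up r i) | i < n.+1].
    by split=> -[x] H; exists x; move: H; rewrite IH E.
  apply: cons_mktuple => [|i]; rewrite /ren_up; first by rewrite unlift_none tnth0.
  by rewrite liftK tnthS.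
Qed.

End Renaming.

Notation env := (nat -> int).

Definition scons (x : int) (e : env) : env := fun i => if i is j.+1 then e j else x.
Definition tl (e : env) : env := fun i => e i.+1.
Notation "x .: e" := (scons x e) (at level 55, right associativity).

Lemma scons_eta e : e 0%N .: tl e = e.
Proof. by apply: functional_extensionality => -[]. Qed.

Definition read (v : nat + int) (e : env) : int :=
  match v with inl i => e i | inr c => c end.

(** Definability with parameters, for predicates on infinite environments: each free
    variable of [phi] stands for a coordinate ([inl]) or for a parameter ([inr]).
    Unlike sets of n-tuples, such predicates can be combined and quantified without
    adjusting n, and coordinates and parameters can be exchanged freely. *)
Definition Def L (S : structure L int) (P : env -> Prop) : Prop :=
  exists (N : nat) (phi : formula L N) (v : 'I_N -> nat + int),
    forall e, P e <-> sat S phi [tuple read (v i) e | i < N].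

Definition depends (n : nat) (P : env -> Prop) : Prop :=
  forall e e', (forall i, (i < n)%N -> e i = e' i) -> P e -> P e'.

Definition env_of n (a : n.-tuple int) : env := fun i => nth 0 a i.

Section Closure.
Variables (L : language) (S : structure L int).
Implicit Types P Q : env -> Prop.

Lemma Def_iff P Q : (forall e, P e <-> Q e) -> Def S P -> Def S Q.
Proof. by move=> PQ [N [phi [v H]]]; exists N, phi, v => e; rewrite -PQ. Qed.

Lemma Def_not P : Def S P -> Def S (fun e => ~ P e).
Proof. by move=> [N [phi [v H]]]; exists N, (Neg phi), v => e; rewrite H. Qed.

Lemma Def_and P Q : Def S P -> Def S Q -> Def S (fun e => P e /\ Q e).
Proof.
move=> [N1 [phi1 [v1 H1]]] [N2 [phi2 [v2 H2]]].
exists (N1 + N2)%N, (And (ren phi1 (@lshift N1 N2)) (ren phi2 (@rshift N1 N2))),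
  (fun i => match split i with inl j => v1 j | inr j => v2 j end) => e /=.
rewrite !sat_ren H1 H2.
pose v (i : 'I_(N1 + N2)) := match split i with inl j => v1 j | inr j => v2 j end.
suff [-> ->] : [tuple tnth [tuple read (v i) e
     | i < N1 + N2] (lshift N2 i) | i < N1] = [tuple read (v1 i) e | i < N1] /\
  [tuple tnth [tuple read (v i) e
     | i < N1 + N2] (rshift N1 i) | i < N2] = [tuple read (v2 i) e | i < N2] by [].
split; apply: eq_from_tnth => i; rewrite !tnth_mktuple /v.
- by rewrite (unsplitK (inl i)).
- by rewrite (unsplitK (inr i)).
Qed.

Lemma Def_ren P (r : nat -> nat) : Def S P -> Def S (fun e => P (fun i => e (r i))).
Proof.
move=> [N [phi [v H]]].
exists N, phi, (fun i => match v i with inl j => inl (r j) | inr c => inr c end) => e.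
rewrite H; suff -> : [tuple read (v i) (fun i => e (r i)) | i < N] =
  [tuple read (match v i with inl j => inl (r j) | inr c => inr c end) e | i < N] by [].
by apply: eq_from_tnth => i; rewrite !tnth_mktuple; case: (v i).
Qed.

(** All the variables of [phi] that read the coordinate 0 are identified with the new
    bound variable; their old slot becomes a dummy parameter. *)
Lemma Def_ex P : Def S P -> Def S (fun e => exists x, P (x .: e)).
Proof.
move=> [N [phi [v H]]].
exists N, (Ex (ren phi (fun i => if v i is inl 0%N then ord0 else lift ord0 i))),
  (fun i => match v i with inl j.+1 => inl j | inl 0%N => inr 0 | inr c => inr c end).
move=> e /=; suff E x : [tuple read (v i) (x .: e) | i < N] =
    [tuple tnth [tuple of x :: [tuple read (match v i with
        inl j.+1 => inl j | inl 0%N => inr 0 | inr c => inr c end) e | i < N]]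
      (if v i is inl 0%N then ord0 else lift ord0 i) | i < N].
  by split=> -[x] Hx; exists x; move: Hx; rewrite sat_ren H E.
apply: eq_from_tnth => i; rewrite !tnth_mktuple.
by case E: (v i) => [[|j]|c]; rewrite ?tnth0 // tnthS tnth_mktuple E.
Qed.

Lemma Def_depends P : Def S P -> exists n, depends n P.
Proof.
move=> [N [phi [v H]]].
pose b (i : 'I_N) := if v i is inl j then j.+1 else 0%N.
exists (\max_(i < N) b i)%N => e e' ee'; rewrite !H.
suff -> : [tuple read (v i) e | i < N] = [tuple read (v i) e' | i < N] by [].
apply: eq_from_tnth => i; rewrite !tnth_mktuple.
have := @leq_bigmax _ b i; rewrite {1}/b.
by case: (v i) => //= j lejn; apply: ee'.
Qed.

(** The coordinates from [n] on are read as 0, the default value of [env_of], and so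
    become parameters. *)
Lemma Def_definable n P : Def S P -> definable S (fun a : n.-tuple int => P (env_of a)).
Proof.
move=> [N [phi [v H]]].
pose r (i : 'I_N) : 'I_(n + N) :=
  if v i is inl j then if insub j is Some k then lshift N k else rshift n i
  else rshift n i.
exists N, (ren phi r), [tuple if v i is inr c then c else 0 | i < N] => a.
rewrite H sat_ren.
suff -> : [tuple read (v i) (env_of a) | i < N] =
  [tuple tnth [tuple of a ++ [tuple if v i is inr c then c else 0 | i < N]] (r i) | i < N] by [].
apply: eq_from_tnth => i; rewrite !tnth_mktuple /r.
case E: (v i) => [j|c] /=; last by rewrite tnth_rshift tnth_mktuple E.
case: insubP => [k _ <-|]; first by rewrite tnth_lshift /env_of (tnth_nth 0).
rewrite -leqNgt => lenj; rewrite tnth_rshift tnth_mktuple E /env_of nth_default //.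
by rewrite size_tuple.
Qed.

Lemma definable_Def n (X : n.-tuple int -> Prop) :
  definable S X -> Def S (fun e => X [tuple e i | i < n]).
Proof.
move=> [m [phi [b H]]].
exists (n + m)%N, phi, (fun i => match split i with
   inl j => inl (j : nat) | inr j => inr (tnth b j) end) => e.
rewrite H.
suff -> : [tuple of [tuple e i | i < n] ++ b] = [tuple read (match split i with
   inl j => inl (j : nat) | inr j => inr (tnth b j) end) e | i < n + m] by [].
apply: eq_from_tnth => i; rewrite tnth_mktuple.
by case: (split_ordP i) => j ->; rewrite ?tnth_lshift ?tnth_rshift ?tnth_mktuple /=.
Qed.

End Closure.

(** [reduct] speaks of positive arities only, whence the harmless increase of the
    number of coordinates. *)
Lemma Def_reduct L1 L2 (S1 : structure L1 int) (S2 : structure L2 int) P :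
  reduct S1 S2 -> Def S1 P -> Def S2 P.
Proof.
move=> red DP; have [n dP] := Def_depends DP.
have {}dP : depends n.+1 P by move=> e e' ee'; apply: dP => i /ltnW; apply: ee'.
have /definable_Def := red n.+1 _ isT (Def_definable n.+1 DP).
apply: Def_iff => e; split; apply: dP => i ltin;
by rewrite /env_of -[i]/(nat_of_ord (Ordinal ltin)) -tnth_nth tnth_mktuple.
Qed.

Lemma reduct_Def L1 L2 (S1 : structure L1 int) (S2 : structure L2 int) :
  (forall P, Def S1 P -> Def S2 P) -> reduct S1 S2.
Proof.
move=> sub n X _ /definable_Def /sub /(Def_definable n) [m [phi [b H]]].
exists m, phi, b => a; rewrite -H; suff -> : [tuple env_of a i | i < n] = a by [].
by apply: eq_from_tnth => i; rewrite tnth_mktuple /env_of (tnth_nth 0).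
Qed.

(** * Boolean combinations and affine forms *)

(** Used both for the predicates definable in a structure and for the quantifier-free
    Presburger predicates. *)
Record bool_class (C : (env -> Prop) -> Prop) : Prop := BoolClass {
  bc_iff : forall P Q : env -> Prop, (forall e, P e <-> Q e) -> C P -> C Q;
  bc_false : C (fun _ => False);
  bc_not : forall P, C P -> C (fun e => ~ P e);
  bc_and : forall P Q, C P -> C Q -> C (fun e => P e /\ Q e)
}.

Section BoolClass.
Variables (C : (env -> Prop) -> Prop) (BC : bool_class C).
Implicit Types P Q : env -> Prop.

Lemma bc_or P Q : C P -> C Q -> C (fun e => P e \/ Q e).
Proof.
move=> CP CQ; apply: (bc_iff BC) (bc_not BC (bc_and BC (bc_not BC CP) (bc_not BC CQ))) => e.
by split=> [/not_and_or[/NNPP|/NNPP]|[H []|H []]]; auto.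
Qed.

Lemma bc_equiv P Q : C P -> C Q -> C (fun e => P e <-> Q e).
Proof.
move=> CP CQ; apply: (bc_iff BC) (bc_or (bc_and BC CP CQ)
  (bc_and BC (bc_not BC CP) (bc_not BC CQ))) => e.
by split=> [|[H H']]; [tauto|case: (classic (P e)); tauto].
Qed.

Lemma bc_const (c : Prop) : C (fun _ => c).
Proof.
by case: (classic c) => H; [apply: (bc_iff BC) (bc_not BC (bc_false BC))
  |apply: (bc_iff BC) (bc_false BC)]; tauto.
Qed.

Lemma bc_exists_in (I : Type) (l : list I) (F : I -> env -> Prop) :
  (forall i, List.In i l -> C (F i)) -> C (fun e => exists i, List.In i l /\ F i e).
Proof.
elim: l => [|i l IH] CF.
  by apply: (bc_iff BC) (bc_false BC) => e; split=> // -[i []].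
apply: (bc_iff BC) (bc_or (CF i (or_introl erefl)) (IH (fun j jl => CF j (or_intror jl)))).
move=> e; split=> [[Fi|[j [jl Fj]]]|[j [[<-|jl] Fj]]].
- by exists i; split; [left|].
- by exists j; split; [right|].
- by left.
- by right; exists j.
Qed.

Lemma bc_forall_in (I : Type) (l : list I) (F : I -> env -> Prop) :
  (forall i, List.In i l -> C (F i)) -> C (fun e => forall i, List.In i l -> F i e).
Proof.
move=> CF; have := bc_not BC (bc_exists_in (F := fun i e => ~ F i e)
  (fun i il => bc_not BC (CF i il))).
apply: (bc_iff BC) => e; split=> [H i il|H [i [il]]]; last by move/(_ (H i il)).
by apply: NNPP => nF; apply: H; exists i.
Qed.

End BoolClass.

Definition int_range (a : int) (n : nat) : list int :=
  List.map (fun i => a + i%:Z) (List.seq 0 n).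

Lemma in_int_range a n x : List.In x (int_range a n) <-> a <= x < a + n%:Z.
Proof.
rewrite List.in_map_iff; split=> [[i [<- /List.in_seq]]|H]; first by lia.
by exists `|x - a|%N; rewrite List.in_seq; lia.
Qed.

Inductive affine : (env -> int) -> Prop :=
  | affine_const c : affine (fun _ => c)
  | affine_var i : affine (fun e => e i)
  | affine_add f g : affine f -> affine g -> affine (fun e => f e + g e)
  | affine_opp f : affine f -> affine (fun e => - f e).

Lemma affine_ext f g : (forall e, f e = g e) -> affine f -> affine g.
Proof. by move=> fg; rewrite (functional_extensionality f g fg). Qed.

Lemma affine_sub f g : affine f -> affine g -> affine (fun e => f e - g e).
Proof. by move=> Af Ag; apply/affine_add/affine_opp. Qed.

Lemma affine_scale c f : affine f -> affine (fun e => c * f e).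
Proof.
move=> Af; have scale_nat n : affine (fun e => n%:Z * f e).
  elim: n => [|n IH]; first by apply: affine_ext (affine_const 0) => e; lia.
  by apply: affine_ext (affine_add Af IH) => e; lia.
by case: (intP c) => [|n|n]; [exact: (scale_nat 0%N)|exact: scale_nat|
  apply: affine_ext (affine_opp (scale_nat n.+1)) => e; lia].
Qed.

Lemma affine_comp f (g : nat -> env -> int) :
  affine f -> (forall i, affine (g i)) -> affine (fun e => f (fun i => g i e)).
Proof.
move=> Af Ag; elim: Af => {f} [c|i|f1 f2 _ IH1 _ IH2|f _ IH].
- exact: affine_const.
- exact: Ag.
- exact: affine_add.
- exact: affine_opp.
Qed.

Lemma affine_tl f : affine f -> affine (fun e => f (tl e)).
Proof. by move=> Af; apply: affine_comp Af (fun i => affine_var i.+1). Qed.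

Lemma affine_scons f : affine f ->
  exists c g, affine g /\ forall x a, f (x .: a) = c * x + g a.
Proof.
elim=> {f} [c|[|i]|f1 f2 _ [c1 [g1 [A1 E1]]] _ [c2 [g2 [A2 E2]]]|f _ [c [g [A E]]]].
- by exists 0, (fun _ => c); split=> [|x a]; [exact: affine_const|lia].
- by exists 1, (fun _ => 0); split=> [|x a /=]; [exact: affine_const|lia].
- by exists 0, (fun e => e i); split=> [|x a /=]; [exact: affine_var|lia].
- exists (c1 + c2), (fun e => g1 e + g2 e).
  by split=> [|x a]; [exact: affine_add|rewrite E1 E2; lia].
- exists (- c), (fun e => - g e).
  by split=> [|x a]; [exact: affine_opp|rewrite E; lia].
Qed.

(** The point with parameter [s] on the affine line through [b] and [b']. *)
Definition along (b b' : env) (s : int) : env := fun i => b i + s * (b' i - b i).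

Lemma affine_along f b b' s : affine f -> f (along b b' s) = f b + s * (f b' - f b).
Proof. by elim=> {f} [c|i|f1 f2 _ IH1 _ IH2|f _ IH]; rewrite ?IH1 ?IH2 ?IH ?/along; lia. Qed.

Section Expansion.
Variables (L : language) (S : structure L int).
Hypothesis group_sub : forall P, Def int_group P -> Def S P.
Implicit Types P Q : env -> Prop.

Lemma Def_read_eq (u w : nat + int) : Def S (fun e => read u e = read w e).
Proof.
exists 2%N, (Eq (Var L (ord0 : 'I_2)) (Var L (ord_max : 'I_2))),
  (fun i => if i == ord0 then u else w) => e /=.
by rewrite !tnth_mktuple.
Qed.

Lemma Def_bool_class : bool_class (Def S).
Proof.
split; [exact: Def_iff | | exact: Def_not | exact: Def_and].
by apply: Def_iff (Def_not (Def_read_eq (inr 0) (inr 0))) => e; split.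
Qed.

Lemma Def_read_add (u v w : nat + int) : Def S (fun e => read u e = read v e + read w e).
Proof.
apply: group_sub.
exists 3%N, (Eq (Var group_language (ord0 : 'I_3)) (@App group_language 3 Plus
    (fun i => Var group_language (if nat_of_ord i is 0%N then inord 1 else ord_max)))),
  (fun i => match nat_of_ord i with 0%N => u | 1%N => v | _ => w end) => e /=.
by rewrite !tnth_mktuple /= inordK.
Qed.

Lemma Def_graph f : affine f -> Def S (fun e => e 0%N = f (tl e)).
Proof.
elim=> {f} [c|i|f1 f2 _ IH1 _ IH2|f _ IH].
- exact: (Def_read_eq (inl 0%N) (inr c)).
- exact: (Def_read_eq (inl 0%N) (inl i.+1)).
- have D1 := Def_ren (fun i => if i is j.+1 then j.+3 else 0%N) IH1.
  have D2 := Def_ren (fun i => if i is j.+1 then j.+3 else 1%N) IH2.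
  have := Def_ex (Def_ex (Def_and (Def_and D1 D2)
     (Def_read_add (inl 2) (inl 0%N) (inl 1%N)))).
  apply: Def_iff => e; rewrite /tl /=; split=> [[x [y [[-> ->] ->]]] //|H].
  by exists (f2 (tl e)), (f1 (tl e)).
- have D := Def_ren (fun i => if i is j.+1 then j.+2 else 0%N) IH.
  have := Def_ex (Def_and D (Def_read_add (inr 0) (inl 0%N) (inl 1%N))).
  apply: Def_iff => e; rewrite /tl /=; split=> [[x [-> H]]|H]; first by lia.
  by exists (f (fun i => e i.+1)); split=> //; lia.
Qed.

Lemma Def_eq f g : affine f -> affine g -> Def S (fun e => f e = g e).
Proof.
move=> Af Ag; have := Def_ex (Def_and (Def_graph Af) (Def_graph Ag)).
apply: Def_iff => e; split=> [[x [/= <- ->]] //|E].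
by exists (f e).
Qed.

(** The variables of the formula are replaced one at a time, each by a fresh quantified
    variable constrained to the graph of its affine form; [j] bounds the slots that do
    not yet read a coordinate or a parameter. *)
Lemma Def_subst P (g : nat -> env -> int) : Def S P -> (forall i, affine (g i)) ->
  Def S (fun e => P (fun i => g i e)).
Proof.
move=> [N [phi [v H]]] Ag.
pose h (i : 'I_N) (e : env) := match v i with inl j => g j e | inr c => c end.
suff Dh : Def S (fun e => sat S phi [tuple h i e | i < N]).
  apply: Def_iff Dh => e; rewrite H.
  suff -> : [tuple read (v i) (fun i => g i e) | i < N] = [tuple h i e | i < N] by [].
  by apply: eq_from_tnth => i; rewrite !tnth_mktuple /h; case: (v i).
have {H} Ah i : affine (h i).
  by rewrite /h; case: (v i) => [j|c]; [exact: Ag|exact: affine_const].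
suff Dread j : forall h : 'I_N -> env -> int, (forall i, affine (h i)) ->
    (forall i : 'I_N, (j <= i)%N -> exists w, forall e, h i e = read w e) ->
    Def S (fun e => sat S phi [tuple h i e | i < N]).
  by apply: (Dread N) => // i; rewrite leqNgt ltn_ord.
elim: j {h Ah} => [|j IH] h Ah Hread.
  have {Hread} /fin_all_exists[w Hw] i := Hread i isT.
  exists N, phi, w => e.
  suff -> : [tuple h i e | i < N] = [tuple read (w i) e | i < N] by [].
  by apply: eq_from_tnth => i; rewrite !tnth_mktuple Hw.
have [lejN|ltNj] := leqP N j.
  by apply: IH Ah _ => i; rewrite leqNgt (leq_trans (ltn_ord i) lejN).
pose i0 := Ordinal ltNj.
pose h' i e := if i == i0 then e 0%N else h i (tl e).
have Dh' : Def S (fun e => sat S phi [tuple h' i e | i < N]).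
  apply: IH => [i|i leji]; rewrite /h'; case: eqP => [_|/eqP nei].
  - exact: affine_var.
  - exact: affine_tl.
  - by exists (inl 0%N).
  - have [|w Hw] := Hread i; first by rewrite ltn_neqAle eq_sym leji andbT.
    by exists (match w with inl k => inl k.+1 | inr c => inr c end) => e; rewrite Hw; case: (w).
apply: Def_iff (Def_ex (Def_and (Def_graph (Ah i0)) Dh')) => e.
have E : [tuple h i e | i < N] = [tuple h' i (h i0 e .: e) | i < N].
  by apply: eq_from_tnth => i; rewrite !tnth_mktuple /h'; case: eqP => [->|].
by split=> [[x /= [->]]|H]; rewrite ?E //; exists (h i0 e); rewrite -E.
Qed.

Lemma Def_tl P : Def S P -> Def S (fun e => P (tl e)).
Proof. exact: (Def_ren succn). Qed.

Lemma Def_scons P f : Def S P -> affine f -> Def S (fun e => P (f e .: e)).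
Proof.
move=> DP Af; apply: Def_iff (Def_ex (Def_and (Def_graph Af) DP)) => e.
by split=> [[x [/= -> ?]] //|H]; exists (f e).
Qed.

Lemma Def_cong m f g : affine f -> affine g ->
  Def S (fun e => exists q, f e = g e + m * q).
Proof.
move=> Af Ag; apply: (Def_ex (P := fun e => f (tl e) = g (tl e) + m * e 0%N)).
by apply: Def_eq; [|apply: affine_add; [|apply/affine_scale/affine_var]]; exact: affine_tl.
Qed.

End Expansion.

(** * Quantifier elimination for Presburger arithmetic *)

(** Quantifier-free Presburger predicates, closed under equivalence so that they can be
    handled semantically. *)
Inductive presburger : (env -> Prop) -> Prop :=
  | presburger_pos f : affine f -> presburger (fun e => 0 < f e)
  | presburger_dvd m f : 0 < m -> affine f -> presburger (fun e => exists q, f e = m * q)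
  | presburger_not P : presburger P -> presburger (fun e => ~ P e)
  | presburger_and P Q : presburger P -> presburger Q -> presburger (fun e => P e /\ Q e)
  | presburger_iff P Q : (forall e, P e <-> Q e) -> presburger P -> presburger Q.

Lemma presburger_bool_class : bool_class presburger.
Proof.
split; [exact: presburger_iff | | exact: presburger_not | exact: presburger_and].
by apply: presburger_iff (presburger_pos (affine_const 0)) => e; split.
Qed.

Definition cong (m x y : int) : Prop := exists q, y = x + m * q.

(** [R] has period [m] as long as [k * x] does not cross a threshold in [H]. *)
Definition periodic_between (k m : int) (H : list int) (R : int -> Prop) : Prop :=
  forall x x', cong m x x' -> (forall h, List.In h H -> k * x < h <-> k * x' < h) ->
    (R x <-> R x').

Definition values (T : list (env -> int)) (a : env) : list int := List.map (fun t => t a) T.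

Lemma in_values T a h : List.In h (values T a) <-> exists2 t, List.In t T & t a = h.
Proof. by rewrite List.in_map_iff; split=> [[t [? ?]]|[t ? ?]]; exists t. Qed.

Lemma list_argmin (I : Type) (l : list I) (Q : I -> Prop) (h : I -> int) :
  (exists2 i, List.In i l & Q i) ->
  exists i, [/\ List.In i l, Q i & forall j, List.In j l -> Q j -> h i <= h j].
Proof.
elim: l => [[i []]|i l IH Hil] //.
case: (classic (exists2 i, List.In i l & Q i)) => [/IH[j [jl Qj jmin]]|nl].
  case: (classic (Q i /\ h i <= h j)) => [[Qi leij]|nQi].
    exists i; split=> [||i' [<-|i'l] Qi'] //=; first by left.
    exact: le_trans leij (jmin _ i'l Qi').
  exists j; split=> [||i' [<-|i'l] Qi'] //=; [by right| |exact: jmin].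
  by apply: NNPP => ?; apply: nQi; split=> //; lia.
case: Hil => j [<-|jl] Qj; last by case: nl; exists j.
exists i; split=> [||i' [<-|i'l] Qi'] //=; first by left.
by case: nl; exists i'.
Qed.

(** Moving by steps of [m] changes [k * x] by [k * m], so that one can land in any
    window of that length. *)
Lemma cong_window k m x h : 0 < k -> 0 < m ->
  exists2 x', cong m x x' & h <= k * x' < h + k * m.
Proof.
move=> k0 m0; exists (x + m * (- ((k * x - h) %/ (k * m))%Z)); first by eexists.
have km0 : 0 < k * m by rewrite mulr_gt0.
have := divz_eq (k * x - h) (k * m); have := modz_ge0 (k * x - h) (lt0r_neq0 km0).
have := ltz_pmod (k * x - h) km0; move: (_ %/ _)%Z (_ %% _)%Z => q r.
by nia.
Qed.

Section Slide.
Variables (k m : int) (H : list int) (R : int -> Prop).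
Hypotheses (k0 : 0 < k) (HR : periodic_between k m H R).

(** Moving upwards by multiples of [m], one stays in [R] up to the next threshold;
    [slide_down] is the mirror image. *)
Lemma slide_up x : R x -> (forall h, List.In h H -> h <= k * x) \/
  exists h, [/\ List.In h H, k * x < h &
    forall x', cong m x x' -> x <= x' -> k * x' < h -> R x'].
Proof.
move=> Rx; case: (classic (exists2 h, List.In h H & k * x < h)) => [above|none].
  right; have [h [hH xh hmin]] := list_argmin id above.
  exists h; split=> // x' xx' lexx' x'h; apply: (proj1 (HR xx' _) Rx) => h' h'H.
  by split=> [/(hmin _ h'H) /=|]; nia.
by left=> h hH; rewrite leNgt; apply/negP => xh; apply: none; exists h.
Qed.

Lemma slide_down x : R x -> (forall h, List.In h H -> k * x < h) \/
  exists h, [/\ List.In h H, h <= k * x &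
    forall x', cong m x x' -> x' <= x -> h <= k * x' -> R x'].
Proof.
move=> Rx; case: (classic (exists2 h, List.In h H & h <= k * x)) => [below|none].
  right; have [h [hH xh hmax]] := list_argmin -%R below.
  exists h; split=> // x' xx' lex'x hx'; apply: (proj1 (HR xx' _) Rx) => h' h'H.
  split=> [|x'h']; first by nia.
  by rewrite ltNge; apply/negP => /(hmax _ h'H) /=; lia.
by left=> h hH; rewrite ltNge; apply/negP => xh; apply: none; exists h.
Qed.

(** The heart of Cooper's method: slide a solution until it comes close to a
    threshold, or, in the absence of thresholds, into a period. *)
Lemma periodic_between_witness x : 0 < m -> R x -> exists2 x', R x' &
  0 <= x' < m \/ exists2 h, List.In h H & - (k * m) <= k * x' - h <= k * m.
Proof.
move=> m0 Rx; case: (slide_up Rx) => [above|[h [hH xh sl]]].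
  case: (slide_down Rx) => [below|[h [hH xh sl]]].
    have [x' xx' x'm] := cong_window x 0 (ltr01 : 0 < 1 :> int) m0.
    exists x'; last by left; lia.
    by apply: (proj1 (HR xx' _) Rx) => h hH; have := above h hH; have := below h hH; lia.
  have [x' xx' x'm] := cong_window x h k0 m0; case: (leP x' x) => lex'x.
    by exists x'; [apply: sl => //; lia|right; exists h => //; lia].
  by exists x => //; right; exists h => //; nia.
have [x' xx' x'm] := cong_window x (h - k * m) k0 m0; case: (leP x x') => lexx'.
  by exists x'; [apply: sl => //; lia|right; exists h => //; lia].
by exists x => //; right; exists h => //; nia.
Qed.

End Slide.

(** Atoms whose coefficient of the eliminated variable has absolute value [k] yield
    thresholds for [k * x]; [k] and [m] multiply up in conjunctions. *)
Lemma presburger_fibers P : presburger P -> exists k m T, [/\ 0 < k, 0 < m,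
  forall t, List.In t T -> affine t &
  forall a, periodic_between k m (values T a) (fun x => P (x .: a))].
Proof.
elim=> {P} [f /affine_scons[c [g [Ag E]]]|m f m0 /affine_scons[c [g [Ag E]]]|
  P _ [k [m [T [? ? ? HT]]]]|
  P Q _ [k1 [m1 [T1 [k10 m10 A1 H1]]]] _ [k2 [m2 [T2 [k20 m20 A2 H2]]]]|
  P Q PQ _ [k [m [T [? ? ? HT]]]]].
- have [c0|c0|c0] := ltgtP c 0.
  + exists (- c), 1, [:: g]; split=> [||t [<-|[]]|a x x' _ H] //; first by lia.
    by have := H (g a) (or_introl erefl); rewrite !E; lia.
  + exists c, 1, [:: fun a => 1 - g a]; split=> [||t [<-|[]]|a x x' _ H] //.
      by apply/affine_sub/Ag/affine_const.
    by have := H (1 - g a) (or_introl erefl); rewrite !E; lia.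
  + by exists 1, 1, nil; split=> // a x x' _ _; rewrite !E c0; lia.
- exists 1, m, nil; split=> // a x x' [q ->] _; rewrite !E.
  by split=> -[r Hr]; [exists (r + c * q)|exists (r - c * q)]; lia.
- by exists k, m, T; split=> // a x x' xx' H; rewrite (HT a x x' xx' H).
- exists (k1 * k2), (m1 * m2),
    (List.map (fun t e => k2 * t e) T1 ++ List.map (fun t e => k1 * t e) T2).
  split=> [||t|a x x' [q Eq] Hh]; rewrite ?mulr_gt0 //.
    move=> tT; case: (List.in_app_or _ _ _ tT) => /List.in_map_iff[t' [<- t'T]];
    by apply: affine_scale; auto.
  have H12 t : (List.In t (values T1 a) -> k1 * x < t <-> k1 * x' < t) /\
               (List.In t (values T2 a) -> k2 * x < t <-> k2 * x' < t).
    split=> /in_values[t' t'T Et]; rewrite -{}Et.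
    - have /Hh : List.In (k2 * t' a) (values
        (List.map (fun t e => k2 * t e) T1 ++ List.map (fun t e => k1 * t e) T2) a).
        apply/in_values; exists (fun e => k2 * t' e) => //; apply/List.in_or_app; left.
        exact: (List.in_map (fun t e => k2 * t e)).
      by rewrite (mulrC k1 k2) -!mulrA !(ltr_pM2l k20).
    - have /Hh : List.In (k1 * t' a) (values
        (List.map (fun t e => k2 * t e) T1 ++ List.map (fun t e => k1 * t e) T2) a).
        apply/in_values; exists (fun e => k1 * t' e) => //; apply/List.in_or_app; right.
        exact: (List.in_map (fun t e => k1 * t e)).
      by rewrite -!mulrA !(ltr_pM2l k10).
  rewrite (H1 a x x') ?(H2 a x x') //.
  + by exists (m1 * q); rewrite Eq; lia.
  + by move=> h; case: (H12 h).
  + by exists (m2 * q); rewrite Eq; lia.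
  + by move=> h; case: (H12 h).
- by exists k, m, T; split=> // a x x' xx' H; rewrite -!PQ; apply: HT.
Qed.

(** Substituting the fraction [u a / k]: the atoms are cleared of denominators. *)
Lemma presburger_subst k u P : presburger P -> 0 < k -> affine u ->
  exists2 Q, presburger Q & forall a x, k * x = u a -> (P (x .: a) <-> Q a).
Proof.
move=> PBP k0 Au; elim: PBP => {P} [f /affine_scons[c [g [Ag E]]]|
  m f m0 /affine_scons[c [g [Ag E]]]|
  P _ [Q PBQ HQ]|P P' _ [Q PBQ HQ] _ [Q' PBQ' HQ']|P P' PP' _ [Q PBQ HQ]].
- exists (fun a => 0 < c * u a + k * g a).
    by apply/presburger_pos/affine_add; apply: affine_scale.
  by move=> a x <-; rewrite E -(pmulr_rgt0 (c * x + g a) k0) mulrDr mulrCA.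
- exists (fun a => exists q, c * u a + k * g a = k * m * q).
    by apply/presburger_dvd/affine_add; [rewrite mulr_gt0| |]; do ?apply: affine_scale.
  move=> a x <-; rewrite E mulrCA -mulrDr; split=> -[q Hq]; exists q; first by rewrite Hq mulrA.
  by apply: (mulfI (lt0r_neq0 k0)); rewrite Hq mulrA.
- by exists (fun a => ~ Q a); [exact: presburger_not|move=> a x /HQ ->].
- exists (fun a => Q a /\ Q' a); first exact: presburger_and.
  by move=> a x kx; rewrite (HQ a x kx) (HQ' a x kx).
- by exists Q => // a x kx; rewrite -PP'; apply: HQ.
Qed.

Lemma presburger_ex_graph k u P : presburger P -> 0 < k -> affine u ->
  presburger (fun a => exists2 x, k * x = u a & P (x .: a)).
Proof.
move=> PBP k0 Au; have [Q PBQ HQ] := presburger_subst PBP k0 Au.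
apply: presburger_iff (presburger_and (presburger_dvd k0 Au) PBQ) => a.
split=> [[[q E] Qa]|[q E Pq]].
  by exists q => //; apply/HQ.
by split; [exists q|apply/(HQ a q)].
Qed.

Lemma presburger_ex P : presburger P -> presburger (fun a => exists x, P (x .: a)).
Proof.
move=> PBP; have [k [m [T [k0 m0 AT HT]]]] := presburger_fibers PBP.
have PB1 : presburger (fun a => exists x, List.In x (int_range 0 `|m|) /\ P (x .: a)).
  apply: (bc_exists_in presburger_bool_class) => x _.
  apply: presburger_iff (presburger_ex_graph PBP ltr01 (affine_const x)) => a.
  by split=> [[y]|Px]; [rewrite mul1r => ->|exists x; rewrite ?mul1r].
have PB2 : presburger (fun a => exists t, List.In t T /\ exists c,
     List.In c (int_range (- (k * m)) `|2 * k * m + 1|) /\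
     exists2 x, k * x = t a + c & P (x .: a)).
  apply: (bc_exists_in presburger_bool_class) => t tT.
  apply: (bc_exists_in presburger_bool_class) => c _.
  by apply: presburger_ex_graph => //; apply: affine_add (affine_const c); apply: AT.
apply: presburger_iff (bc_or presburger_bool_class PB1 PB2) => a; split.
  by move=> [[x [_ Px]]|[t [_ [c [_ [x _ Px]]]]]]; exists x.
move=> [x Px].
have [x' Px' [x'm|[h /in_values[t tT <-] Hx']]] := periodic_between_witness k0 (HT a) m0 Px.
  by left; exists x'; rewrite in_int_range; split=> //; lia.
right; exists t; split=> //; exists (k * x' - t a); rewrite in_int_range.
by split; [lia|exists x' => //; lia].
Qed.

Lemma Def_ordered_group_presburger P : Def int_ordered_group P -> presburger P.
Proof.
pose O := int_ordered_group.
have eval_affine N (t : term ordered_group_language N) (g : 'I_N -> env -> int) :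
    (forall i, affine (g i)) -> affine (fun e => eval O [tuple g i e | i < N] t).
  move=> Ag; elim: t => [i|[] ts IH] /=.
  - by apply: affine_ext (Ag i) => e; rewrite tnth_mktuple.
  - apply: affine_ext (affine_add (IH ord0) (IH ord_max)) => e.
    by rewrite !tnth_mktuple.
  - exact: affine_const.
have sat_PB N (phi : formula ordered_group_language N) (g : 'I_N -> env -> int) :
    (forall i, affine (g i)) -> presburger (fun e => sat O phi [tuple g i e | i < N]).
  elim: phi g => {N} [N s t|N [] ts|N psi IH|N psi IH chi IH'|N psi IH] g Ag /=.
  - have [As At] := (eval_affine _ s g Ag, eval_affine _ t g Ag).
    apply: presburger_iff (presburger_and (presburger_not (presburger_pos (affine_sub As At)))
      (presburger_not (presburger_pos (affine_sub At As)))) => e.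
    by split=> [[]|->]; [move: (eval _ _ _) (eval _ _ _)|]; lia.
  - have A i := eval_affine _ (ts i) g Ag.
    apply: presburger_iff (presburger_pos (affine_sub (A ord_max) (A ord0))) => e.
    by rewrite /int_rel !tnth_mktuple subr_gt0.
  - exact/presburger_not/IH.
  - by apply: presburger_and; [apply: IH|apply: IH'].
  - pose h (i : 'I_N.+1) e := if unlift ord0 i is Some j then g j (tl e) else e 0%N.
    have Ah i : affine (h i).
      by rewrite /h; case: (unlift ord0 i) => [j|]; [exact: affine_tl|exact: affine_var].
    apply: presburger_iff (presburger_ex (IH h Ah)) => e.
    suff E x : [tuple of x :: [tuple g i e | i < N]] = [tuple h i (x .: e) | i < N.+1].
      by split=> -[x Hx]; exists x; move: Hx; rewrite E.
    by apply: cons_mktuple => [|i]; rewrite /h ?unlift_none // liftK.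
move=> [N [phi [v H]]]; apply: presburger_iff (sat_PB N phi (fun i => read (v i)) _) => [e|i].
  by rewrite H.
by case: (v i) => [j|c]; [exact: affine_var|exact: affine_const].
Qed.

(** * Pumping *)

(** The condition under which the truth of the atoms [0 < u] and [m %| u], for [m]
    dividing [M], cannot change along the ray from [u] through [v]: the value keeps its
    residue and moves away from 0. *)
Definition grows (M u v : int) : Prop :=
  [/\ cong M u v, 0 < u -> u <= v & u <= 0 -> v <= u].

Lemma presburger_ray P : presburger P -> exists M F, [/\ 0 < M,
  forall f, List.In f F -> affine f &
  forall b b', (forall f, List.In f F -> grows M (f b) (f b')) ->
    forall s, 0 <= s -> P b <-> P (along b b' s)].
Proof.
elim=> {P} [f Af|m f m0 Af|P _ [M [F [M0 AF HF]]]|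
  P Q _ [M1 [F1 [M10 A1 H1]]] _ [M2 [F2 [M20 A2 H2]]]|
  P Q PQ _ [M [F [M0 AF HF]]]].
- exists 1, [:: f]; split=> [||b b' /(_ f (or_introl erefl))[_ up down] s s0] //.
    by move=> _ [<-|[]].
  by rewrite affine_along //; nia.
- exists m, [:: f]; split=> [||b b' /(_ f (or_introl erefl))[[r E] _ _] s s0] //.
    by move=> _ [<-|[]].
  rewrite affine_along // E; split=> -[q Hq].
    by exists (q + s * r); rewrite Hq; lia.
  by exists (q - s * r); move: Hq; lia.
- by exists M, F; split=> // b b' Hb s s0; rewrite (HF b b' Hb s s0).
- exists (M1 * M2), (F1 ++ F2)%list; split=> [|f|b b' Hb s s0].
  + by rewrite mulr_gt0.
  + by move=> fF; case: (List.in_app_or _ _ _ fF) => ?; auto.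
  + rewrite (H1 b b' _ s s0) ?(H2 b b' _ s s0) // => f fF.
    * case: (Hb f); first by apply: List.in_or_app; right.
      by case=> q E ? ?; split=> //; exists (M1 * q); rewrite E; lia.
    * case: (Hb f); first by apply: List.in_or_app; left.
      by case=> q E ? ?; split=> //; exists (M2 * q); rewrite E; lia.
- by exists M, F; split=> // b b' Hb s s0; rewrite -!PQ; apply: HF.
Qed.

Definition infinite (I : nat -> Prop) : Prop := forall N, exists2 i, (N <= i)%N & I i.

Lemma infinite_or I A B : infinite I -> (forall i, I i -> A i \/ B i) ->
  infinite (fun i => I i /\ A i) \/ infinite (fun i => I i /\ B i).
Proof.
move=> infI AB; apply: NNPP => /not_or_and[/not_all_ex_not[N1 H1] /not_all_ex_not[N2 H2]].
have [i lei Ii] := infI (maxn N1 N2); case: (AB i Ii) => H.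
- by apply: H1; exists i => //; apply: leq_trans lei; apply: leq_maxl.
- by apply: H2; exists i => //; apply: leq_trans lei; apply: leq_maxr.
Qed.

Lemma infinite_color I (c : nat -> nat) K : infinite I -> (forall i, I i -> (c i < K)%N) ->
  exists r, infinite (fun i => I i /\ c i = r).
Proof.
elim: K I => [|K IH] I infI cK; first by have [i _ /cK] := infI 0%N.
have lt_or_eq i : I i -> (c i < K)%N \/ c i = K by move=> /cK; lia.
case: (infinite_or infI lt_or_eq) => inf; last by exists K.
have [|r infr] := IH _ inf; first by move=> i [].
by exists r => N; have [i ? [[]]] := infr N; exists i.
Qed.

(** The indices at which [w] takes its least value over the rest of [I] are infinite
    in number, and [w] is nondecreasing on them. *)
Lemma infinite_nondecreasing I (w : nat -> nat) : infinite I ->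
  infinite (fun i => I i /\ forall j, I j -> (i <= j)%N -> (w i <= w j)%N).
Proof.
move=> infI N; have [i leNi Ii] := infI N.
move: {-1}(w i) (leqnn (w i)) => n; elim: n i leNi Ii => [|n IH] i leNi Ii wi.
  by exists i => //; split=> // j _ _; move: wi; lia.
case: (classic (forall j, I j -> (i <= j)%N -> (w i <= w j)%N)) => [?|]; first by exists i.
move=> /not_all_ex_not[j nj]; apply: (IH j); [|by apply: NNPP; tauto|].
  by apply: NNPP => ?; apply: nj; lia.
by apply: NNPP => ?; apply: nj; lia.
Qed.

Lemma infinite_grows I (u : nat -> int) M : 0 < M -> infinite I ->
  exists J, [/\ infinite J, forall i, J i -> I i &
    forall i j, J i -> J j -> (i < j)%N -> grows M (u i) (u j)].
Proof.
move=> M0 infI.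
have colM i : I i -> (`|(u i %% M)%Z| < `|M|)%N.
  by move=> _; have := ltz_pmod (u i) M0; have := modz_ge0 (u i) (lt0r_neq0 M0); lia.
have [r infr] := infinite_color infI colM.
have sgn i : (I i /\ `|(u i %% M)%Z|%N = r) -> 0 < u i \/ u i <= 0 by lia.
have congM i j : `|(u i %% M)%Z|%N = r -> `|(u j %% M)%Z|%N = r -> cong M (u i) (u j).
  move=> Ei Ej; exists ((u j %/ M)%Z - (u i %/ M)%Z).
  have := modz_ge0 (u i) (lt0r_neq0 M0); have := modz_ge0 (u j) (lt0r_neq0 M0).
  rewrite {2}(divz_eq (u j) M) {2}(divz_eq (u i) M).
  by move: Ei Ej; move: (_ %/ _)%Z (_ %% _)%Z (_ %/ _)%Z (_ %% _)%Z => q1 r1 q2 r2; lia.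
case: (infinite_or infr sgn) => /(infinite_nondecreasing (fun i => `|u i|%N)) inf.
- eexists; split; [exact: inf|by move=> i [[[]]]|].
  move=> i j [[[Ii Ei] ui] Hi] [[[Ij Ej] uj] Hj] ltij; split; first exact: congM.
  + by move=> _; have := Hi j (conj (conj Ij Ej) uj) (ltnW ltij); lia.
  + by lia.
- eexists; split; [exact: inf|by move=> i [[[]]]|].
  move=> i j [[[Ii Ei] ui] Hi] [[[Ij Ej] uj] Hj] ltij; split; first exact: congM.
  + by lia.
  + by move=> _; have := Hi j (conj (conj Ij Ej) uj) (ltnW ltij); lia.
Qed.

Lemma infinite_grows_list (F : list (env -> int)) (b : nat -> env) M : 0 < M ->
  exists J, infinite J /\ forall i j, J i -> J j -> (i < j)%N ->
    forall f, List.In f F -> grows M (f (b i)) (f (b j)).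
Proof.
move=> M0; elim: F => [|f F [I [infI HI]]].
  by exists (fun _ => True); split=> // N; exists N.
have [J [infJ JI HJ]] := infinite_grows (fun i => f (b i)) M0 infI.
exists J; split=> // i j Ji Jj ltij g [<-|gF]; first exact: HJ.
by apply: HI => //; apply: JI.
Qed.

(** In the manner of Dickson's lemma, among infinitely many points of [P] two are
    comparable with respect to [grows] for all the forms that occur in [P]; the whole
    ray through them then lies in [P]. *)
Lemma presburger_pump P (b : nat -> env) : presburger P -> (forall i, P (b i)) ->
  exists i j, (i < j)%N /\ forall s, 0 <= s -> P (along (b i) (b j) s).
Proof.
move=> /presburger_ray[M [F [M0 AF HF]]] Pb.
have [J [infJ HJ]] := infinite_grows_list F b M0.
have [i _ Ji] := infJ 0%N; have [j ltij Jj] := infJ i.+1.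
exists i, j; split=> // s s0.
exact: (proj1 (HF (b i) (b j) (HJ i j Ji Jj ltij) s s0)).
Qed.

(** * Sets in the plane with finite fibres *)

(** Both ends are meant at once: [s] and [s'] may be of opposite signs. *)
Definition periodic_at_infinity (U : int -> Prop) : Prop :=
  exists M N : int, 0 < M /\
    forall s s' : int, N <= `|s| -> N <= `|s'| -> cong M s s' -> (U s <-> U s').

Lemma common_period (I : Type) (l : list I) (U : I -> int -> Prop) :
  (forall i, List.In i l -> periodic_at_infinity (U i)) ->
  exists M N : int, 0 < M /\ forall i, List.In i l -> forall s s' : int, N <= `|s| -> N <= `|s'| ->
    cong M s s' -> (U i s <-> U i s').
Proof.
elim: l => [|i l IH] Ul; first by exists 1, 0.
have [M1 [N1 [M10 H1]]] := Ul i (or_introl erefl).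
have [j jl|M2 [N2 [M20 H2]]] := IH; first by apply: Ul; right.
exists (M1 * M2), (`|N1| + `|N2|); split=> [|j [<-|jl] s s' Ns Ns' [q E]].
- by rewrite mulr_gt0.
- by apply: H1; [lia|lia|exists (M2 * q); rewrite E; lia].
- by apply: H2 => //; [lia|lia|exists (M1 * q); rewrite E; lia].
Qed.

Lemma list_bound (l : list int) : exists2 C : int, 0 < C & forall x, List.In x l -> `|x| < C.
Proof.
elim: l => [|x l [C C0 HC]]; first by exists 1.
exists (C + `|x|) => [|y [<-|/HC]]; lia.
Qed.

Section Planar.
Variables (Z : int -> int -> Prop) (m : int) (lines : list (int * int)).
Let height (l : int * int) (s : int) : int := l.1 * s + l.2.
Hypothesis m0 : 0 < m.
Hypothesis Zperiodic : forall s, periodic_between 1 m (List.map (height^~ s) lines) (Z s).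
Hypothesis Zfin : forall s y, Z s y ->
  (exists2 l, List.In l lines & height l s <= y) /\
  (exists2 l, List.In l lines & y < height l s).
Hypothesis Zper : forall al c : int, periodic_at_infinity (fun s => Z s (al * s + c)).
Hypothesis Zfar : forall s : int, 0 <= s -> exists2 y, Z s y &
  forall l, List.In l lines -> s < `|y - height l s|.

Lemma planar_down s y : Z s y -> exists2 l, List.In l lines & height l s <= y /\
  forall y', cong m y y' -> y' <= y -> height l s <= y' -> Z s y'.
Proof.
move=> Zy; case: (slide_down ltr01 (@Zperiodic s) Zy) => [|[h [/List.in_map_iff[l [<- ll]]]]].
  move=> none; have [[l ll ly] _] := Zfin Zy.
  by have := none _ (List.in_map (height^~ s) _ _ ll); lia.
by rewrite mul1r => ly H; exists l => //; split=> // y'; have := H y'; rewrite mul1r.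
Qed.

Lemma planar_up s y : Z s y -> exists2 l, List.In l lines & y < height l s /\
  forall y', cong m y y' -> y <= y' -> y' < height l s -> Z s y'.
Proof.
move=> Zy; case: (slide_up ltr01 (@Zperiodic s) Zy) => [|[h [/List.in_map_iff[l [<- ll]]]]].
  move=> none; have [_ [l ll ly]] := Zfin Zy.
  by have := none _ (List.in_map (height^~ s) _ _ ll); lia.
by rewrite mul1r => ly H; exists l => //; split=> // y'; have := H y'; rewrite mul1r.
Qed.

(** No such [Z] exists.  [C] bounds the intercepts, so that for offsets [c] of absolute
    value at least [C] the line l.1 * s + c lies beyond all the lines parallel to [l],
    and for |s| as large as below the remaining lines are ordered by their slopes.  A
    line [l] is good if [Z] contains, at +oo, points just above the pencil of parallels
    of [l].  From a good line of least slope, passing to -oo and sliding upwards, then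
    back to +oo and sliding downwards, one reaches a good line of smaller slope. *)
Lemma planar_false : False.
Proof.
have [C C0 HC] := list_bound (List.map snd lines).
have {}HC l : List.In l lines -> `|l.2| < C by move=> ll; apply: HC; apply: List.in_map.
pose offs := List.list_prod (List.map fst lines) (int_range (- C - m) `|2 * C + 2 * m|).
have [M [N [M0 HM]]] := @common_period _ offs (fun p s => Z s (p.1 * s + p.2))
  (fun p _ => Zper p.1 p.2).
(* A multiple of the common period M: s and - s are then congruent, and Z agrees at
   both on the parallels under consideration. *)
pose s : int := M * (`|N| + 2 * C + 3 * m).
have sbig : `|N| + 2 * C + 3 * m <= s by rewrite /s; nia.
have flip (l : int * int) (c : int) : List.In l lines -> - C - m <= c < C + m ->
    Z s (l.1 * s + c) <-> Z (- s) (l.1 * (- s) + c).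
  move=> ll cb; apply: (HM (l.1, c)); [|lia|lia|].
    by apply: List.in_prod; [exact: List.in_map|apply/in_int_range; lia].
  by exists (- 2 * (`|N| + 2 * C + 3 * m)); rewrite /s; lia.
pose good (l : int * int) := exists2 c : int, C <= c < C + m & Z s (l.1 * s + c).
have down y : Z s y -> exists2 l, List.In l lines & height l s <= y /\
    (l.1 * s + C + m <= y -> good l).
  move=> /planar_down[l ll [ly H]]; exists l => //; split=> // far.
  have [y' yy' y'b] := cong_window y (l.1 * s + C) ltr01 m0.
  exists (y' - l.1 * s); first by lia.
  rewrite addrC subrK; apply: H => //; first by lia.
  by have := HC l ll; rewrite /height; lia.
have some_good : exists2 l, List.In l lines & good l.
  have [y Zy fary] : exists2 y, Z s y & forall l, List.In l lines -> s < `|y - height l s|.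
    by apply: Zfar; lia.
  have [l ll [ly H]] := down y Zy; exists l => //; apply: H.
  by have := fary l ll; have := HC l ll; move: ly; rewrite /height; lia.
have [l0 [l0l [c0 c0b Zc0] l0min]] := list_argmin fst some_good.
have Zneg : Z (- s) (l0.1 * (- s) + c0) by apply/flip => //; lia.
have [l1 l1l [l1up H1]] := planar_up Zneg.
have slope1 : l1.1 < l0.1 by have := HC l1 l1l; move: l1up; rewrite /height; nia.
have [y yy yb] := cong_window (l0.1 * (- s) + c0) (l1.1 * (- s) - C - m) ltr01 m0.
have Zy : Z (- s) y.
  apply: H1 => //; last by have := HC l1 l1l; rewrite /height; lia.
  have gap : l1.1 * s + s <= l0.1 * s by nia.
  by lia.
have {}Zy : Z s (l1.1 * s + (y + l1.1 * s)).
  by apply/flip => //; [lia|have -> : l1.1 * (- s) + (y + l1.1 * s) = y by lia].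
have [l2 l2l [l2down H2]] := down _ Zy.
have slope2 : l2.1 < l1.1 by have := HC l2 l2l; move: l2down; rewrite /height; nia.
have gap : l2.1 * s + s <= l1.1 * s by nia.
have good2 : good l2 by apply: H2; lia.
by have := l0min l2 l2l good2; lia.
Qed.

End Planar.

(** * Unary definable sets *)

Section Order.
Variables (L : language) (S : structure L int).
Hypothesis group_sub : forall P, Def int_group P -> Def S P.
Let BC := Def_bool_class S.

Lemma Def_presburger P : Def S (fun e => e 0%N < e 1%N) -> presburger P -> Def S P.
Proof.
move=> Dlt; elim=> {P} [f Af|m f m0 Af|P _ IH|P Q _ IH _ IH'|P Q PQ _ IH].
- apply: (Def_subst group_sub (g := fun i => if i is 0%N then fun _ => 0 else f) Dlt) => -[|i] //.
  exact: affine_const.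
- apply: Def_iff (Def_cong group_sub m Af (affine_const 0)) => e.
  by split=> -[q E]; exists q; lia.
- exact: Def_not.
- exact: Def_and.
- exact: Def_iff IH.
Qed.

(** [0 < e 1 - e 0] is equivalent to [U (e 1 - e 0)] outside an interval, and an
    interval is a finite set. *)
Lemma ray_order (U : int -> Prop) (N : int) : Def S (fun e => U (e 0%N)) ->
  (forall q, N <= q -> U q) -> (forall q, q <= - N -> ~ U q) ->
  Def S (fun e => e 0%N < e 1%N).
Proof.
move=> DU up down.
have Ad : affine (fun e => e 1%N - e 0%N) by apply: affine_sub; apply: affine_var.
have Dd : Def S (fun e => U (e 1%N - e 0%N)) by apply: (Def_scons group_sub DU Ad).
have Drange (l : list int) : Def S (fun e => exists c, List.In c l /\ e 1%N - e 0%N = c).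
  by apply: (bc_exists_in BC) => c _; apply: Def_eq => //; apply: affine_const.
apply: Def_iff (bc_or BC (Def_and Dd (Def_not (Drange (int_range (- `|N|) `|N|.+1))))
  (Drange (int_range 1 `|N|))) => e.
have inr a n : (exists c, List.In c (int_range a n) /\ e 1%N - e 0%N = c) <->
    a <= e 1%N - e 0%N < a + n%:Z.
  by rewrite -in_int_range; split=> [[c [? ->]]|?] //; exists (e 1%N - e 0%N).
rewrite !inr; split=> [[[Ud nr]|]|lt01]; [|lia|].
  rewrite ltNge; apply/negP => le10; apply: nr.
  suff : ~ (e 1%N - e 0%N <= - N) by lia.
  by move/down.
case: (leP N (e 1%N - e 0%N)) => [/up ?|]; first by left; split=> //; lia.
by right; lia.
Qed.

End Order.

Section Intermediate.
Variables (L : language) (S : structure L int).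
Hypothesis group_sub : forall P, Def int_group P -> Def S P.
Hypothesis sub_presburger : forall P, Def S P -> presburger P.
Hypothesis no_order : ~ Def S (fun e => e 0%N < e 1%N).
Let BC := Def_bool_class S.
Let group_refl P (DP : Def int_group P) := DP.

(** If [U] held at [x] but not at [x'], then the set of all [r] such that [x + m * r]
    lies in [U] would be a half-line up to finitely many points. *)
Lemma ends_agree (U : int -> Prop) (m N : int) : 0 < m -> Def S (fun e => U (e 0%N)) ->
  (forall x x', N <= x -> N <= x' -> cong m x x' -> (U x <-> U x')) ->
  (forall x x', x <= - N -> x' <= - N -> cong m x x' -> (U x <-> U x')) ->
  forall x x', N <= x -> x' <= - N -> cong m x x' -> (U x <-> U x').
Proof.
move=> m0 DU up down x x' xN x'N [q E].
have DV : Def S (fun e => U (x + m * e 0%N)).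
  apply: (Def_scons group_sub DU (f := fun e => x + m * e 0%N)).
  by apply: affine_add (affine_const _) _; apply: affine_scale; apply: affine_var.
have Vup r : 0 <= r -> (U x <-> U (x + m * r)) by move=> r0; apply: up; [|nia|exists r].
have Vdown r : r <= q -> (U x' <-> U (x + m * r)).
  by move=> rq; apply: down; [|nia|exists (r - q); rewrite E; lia].
split=> Ux; apply: NNPP => nUx; apply: no_order.
- apply: (ray_order group_sub (N := `|q|) DV) => r rq.
    by apply: (proj1 (Vup r _)) Ux; lia.
  by move=> Ur; apply/nUx/(proj2 (Vdown r _)) => //; lia.
- apply: (ray_order group_sub (N := `|q|) (U := fun r => ~ U (x + m * r)) (Def_not DV)) => r rq.
    by move=> Ur; apply/nUx/(proj2 (Vup r _)) => //; lia.
  by apply; apply: (proj1 (Vdown r _)) Ux; lia.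
Qed.

Lemma unary_periodic (U : int -> Prop) : Def S (fun e => U (e 0%N)) -> periodic_at_infinity U.
Proof.
move=> DU; have [k [m [T [k0 m0 _ HT]]]] := presburger_fibers (sub_presburger DU).
have {HT} := HT (fun _ => 0); move: (values T _) => H HU.
have [N N0 HN] := list_bound H.
have up x x' : N <= x -> N <= x' -> cong m x x' -> (U x <-> U x').
  by move=> xN x'N /HU; apply=> h /HN; nia.
have down x x' : x <= - N -> x' <= - N -> cong m x x' -> (U x <-> U x').
  by move=> xN x'N /HU; apply=> h /HN; nia.
have agree := ends_agree m0 DU up down.
exists m, N; split=> // x x' Nx Nx' xx'.
have x'x : cong m x' x by case: xx' => q ->; exists (- q); lia.
case: (leP 0 x) => x0; case: (leP 0 x') => x'0.
- by apply: up => //; lia.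
- by apply: agree => //; lia.
- by apply: iff_sym; apply: agree => //; lia.
- by apply: down => //; lia.
Qed.

(** * Families of finite sets and the induction *)

(** Were the distance unbounded, the set of the triples (l, x, a) with [X (x .: a)] and
    [x] at a distance greater than l from all [t a] would contain a sequence with
    l = 0, 1, 2 and so on.  Pumping this sequence gives a line in the space of the
    points a over which the distance to the lines tends to infinity. *)
Lemma fibers_near_lines X m T : 0 < m -> (forall t, List.In t T -> affine t) -> Def S X ->
  (forall a, periodic_between 1 m (values T a) (fun x => X (x .: a))) ->
  (forall a x, X (x .: a) -> (exists2 t, List.In t T & t a <= x) /\
    exists2 t, List.In t T & x < t a) ->
  exists C : int, forall a x, X (x .: a) -> exists2 t, List.In t T & `|x - t a| <= C.
Proof.
move=> m0 AT DX HX Xfin; apply: NNPP => unbounded.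
pose Q e := X (tl e) /\ forall t, List.In t T ->
  0 < (e 1%N - t (tl (tl e))) - e 0%N \/ 0 < (t (tl (tl e)) - e 1%N) - e 0%N.
have PBQ : presburger Q.
  apply: presburger_and; first by apply/sub_presburger/Def_tl.
  apply: (bc_forall_in presburger_bool_class) => t tT.
  have A2 : affine (fun e => t (tl (tl e))) by exact: affine_tl (affine_tl (AT t tT)).
  apply: (bc_or presburger_bool_class); apply: presburger_pos; do 2?apply: affine_sub => //;
  exact: affine_var.
have /functional_choice[b Hb] (i : nat) : exists b, Q b /\ b 0%N = i%:Z.
  apply: NNPP => none; apply: unbounded; exists i%:Z => a x Xx.
  apply: NNPP => far; apply: none; exists (i%:Z .: x .: a); split=> //; split=> // t tT.
  change (0 < (x - t a) - i%:Z \/ 0 < (t a - x) - i%:Z).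
  suff : ~~ (`|x - t a| <= i%:Z) by lia.
  by apply/negP => near; apply: far; exists t.
have [i [j [ltij ray]]] := presburger_pump PBQ (fun i => proj1 (Hb i)).
pose a0 := tl (tl (b i)); pose a1 := tl (tl (b j)).
pose Z s y := X (y .: along a0 a1 s).
pose lines := List.map (fun t => (t a1 - t a0, t a0)) T.
have height t s : List.In t T -> t (along a0 a1 s) = (t a1 - t a0) * s + t a0.
  by move=> tT; rewrite affine_along; [lia|exact: AT].
apply: (@planar_false Z m lines) => // [s|s y Zy|al c|s s0].
- suff -> : List.map (fun l : int * int => l.1 * s + l.2) lines = values T (along a0 a1 s).
    exact: HX.
  by rewrite /lines List.map_map; apply: List.map_ext_in => t /height ->.
- have [[t tT ty] [u uT uy]] := Xfin _ _ Zy.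
  split; [exists (t a1 - t a0, t a0)|exists (u a1 - u a0, u a0)] => //=;
    by [apply: (List.in_map (fun t => (t a1 - t a0, t a0)))|rewrite -height].
- apply: unary_periodic.
  apply: (Def_subst group_sub (g := fun i e => if i is j.+1 then along a0 a1 (e 0%N) j
    else al * e 0%N + c) _ _ : Def S (fun e => Z (e 0%N) (al * e 0%N + c))) => // -[|l].
    by apply: affine_add (affine_const _); apply: affine_scale; apply: affine_var.
  apply: affine_add (affine_const _) _.
  by apply: affine_ext (affine_scale (a1 l - a0 l) (affine_var 0)) => e; lia.
- have [Xs fars] := ray s s0; exists (along (b i) (b j) s 1%N).
    by move: Xs; rewrite -(scons_eta (tl (along _ _ _))).
  move=> _ /List.in_map_iff[t [<- tT]] /=; rewrite -height //.
  have : along (b i) (b j) s 0%N = i%:Z + s * (j%:Z - i%:Z).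
    by rewrite /along !(proj2 (Hb _)).
  move: (fars t tT); change (tl (tl (along (b i) (b j) s))) with (along a0 a1 s).
  move: (along _ _ _ 0%N) (along _ _ _ 1%N) (t _) => e0 e1 u far E0.
  have : s <= i%:Z + s * (j%:Z - i%:Z) by nia.
  by lia.
Qed.

Section Induction.
Variable n : nat.
Hypothesis IHn : forall P, Def S P -> depends n P -> Def int_group P.

(** [X] consists of the points (t(a) + c, a), for finitely many pairs (t, c), with [a]
    in the set where [X (t a + c .: a)], which has one coordinate less. *)
Lemma Def_group_near_lines X T (C : int) : Def S X -> depends n.+1 X ->
  (forall t, List.In t T -> affine t) ->
  (forall t, List.In t T -> forall e e', (forall i, (i < n)%N -> e i = e' i) -> t e = t e') ->
  (forall a x, X (x .: a) -> exists2 t, List.In t T & `|x - t a| <= C) ->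
  Def int_group X.
Proof.
move=> DX dX AT dT near.
have D : Def int_group (fun e => exists t, List.In t T /\ exists c,
    List.In c (int_range (- `|C|) `|2 * `|C| + 1|) /\
    (e 0%N = t (tl e) + c /\ X (t (tl e) + c .: tl e))).
  apply: (bc_exists_in (Def_bool_class int_group)) => t tT.
  apply: (bc_exists_in (Def_bool_class int_group)) => c _.
  have Atc : affine (fun a => t a + c) by apply: affine_add (affine_const c); apply: AT.
  apply: Def_and; first exact: (Def_graph group_refl Atc).
  apply: (Def_tl (P := fun a => X (t a + c .: a))); apply: IHn; first exact: Def_scons.
  move=> a a' aa'; rewrite (dT t tT _ _ aa'); apply: dX => -[|i] //=; exact: aa'.
apply: Def_iff D => e; split=> [[t [tT [c [_ [E Xt]]]]]|Xe].
  by rewrite -(scons_eta e) E.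
have := Xe; rewrite -{1}(scons_eta e) => /near[t tT ne].
exists t; split=> //; exists (e 0%N - t (tl e)); rewrite in_int_range.
by rewrite [t (tl e) + _]addrC subrK scons_eta; split=> //; lia.
Qed.

(** On a residue class modulo [m] a fibre of [X] is finite or cofinite, and it is
    cofinite if and only if its trace on the class meets each of the translates of
    that trace by a multiple of [m].  This condition [Y] does not mention the order; it
    singles out the periodic part of [X]. *)
Lemma Def_group_fibered X m T : 0 < m -> (forall t, List.In t T -> affine t) ->
  Def S X -> depends n.+1 X ->
  (forall a, periodic_between 1 m (values T a) (fun x => X (x .: a))) -> Def int_group X.
Proof.
move=> m0 AT DX dX HX.
(* As X depends on n + 1 coordinates only, the forms can be made to
   depend on n coordinates. *)
pose trunc (a : env) : env := fun i => if (i < n)%N then a i else 0.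
have truncE a x : X (x .: a) <-> X (x .: trunc a).
  by split; apply: dX => -[|i] //= ltin; rewrite /trunc -ltnS ltin.
pose T' := List.map (fun t a => t (trunc a)) T.
have AT' t : List.In t T' -> affine t.
  move=> /List.in_map_iff[t' [<- /AT At']]; apply: affine_comp At' _ => i.
  by rewrite /trunc; case: (i < n)%N; [exact: affine_var|exact: affine_const].
have dT' t : List.In t T' -> forall e e', (forall i, (i < n)%N -> e i = e' i) -> t e = t e'.
  move=> /List.in_map_iff[t' [<- _]] e e' ee'; congr t'.
  by apply: functional_extensionality => i; rewrite /trunc; case: ifP => // /ee'.
have {}HX a : periodic_between 1 m (values T' a) (fun x => X (x .: a)).
  move=> x x' xx' H; rewrite !(truncE a); apply: HX => // h; rewrite /values => hT.
  by apply: H; rewrite /values List.map_map.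
move: T' AT' dT' HX => {T AT trunc truncE} T AT dT HX.
pose Y e := forall z, exists q, X (e 0%N + m * q .: tl e) /\ X (e 0%N + m * q + m * z .: tl e).
pose X' e := ~ (X e <-> Y e).
have DY : Def S Y.
  have DYq : Def S (fun e => X (e 2 + m * e 0%N .: tl (tl (tl e))) /\
      X (e 2 + m * e 0%N + m * e 1%N .: tl (tl (tl e)))).
    have Am i : affine (fun e => m * e i) by apply/affine_scale/affine_var.
    apply: Def_and.
      apply: (Def_subst group_sub (g := fun i e => if i is j.+1 then e j.+3
        else e 2 + m * e 0%N) DX) => -[|i].
        by apply: affine_add => //; apply: affine_var.
      exact: affine_var.
    apply: (Def_subst group_sub (g := fun i e => if i is j.+1 then e j.+3
      else e 2 + m * e 0%N + m * e 1%N) DX) => -[|i].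
      by do 2 apply: affine_add => //; apply: affine_var.
    exact: affine_var.
  apply: Def_iff (Def_not (Def_ex (Def_not (Def_ex DYq)))) => e.
  split=> [H z|H [z nz]]; first by apply: NNPP => nz; apply: H; exists z.
  by apply: nz; apply: H.
have Ycong a x x' : cong m x x' -> Y (x .: a) <-> Y (x' .: a).
  move=> [r ->]; split=> H z; case: (H z) => q /= [H1 H2].
    by exists (q - r); split; [move: H1|move: H2]; congr X; congr scons; lia.
  by exists (q + r); split; [move: H1|move: H2]; congr X; congr scons; lia.
have dY : depends n.+1 Y.
  move=> e e' ee' H z; have [q [H1 H2]] := H z; exists q.
  by split; [apply: dX H1|apply: dX H2] => -[|i] ltin /=; rewrite ?ee' // /tl ee'.
have GY : Def int_group Y.
  have D : Def int_group (fun e => exists r, List.In r (int_range 0 `|m|) /\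
      ((exists q, e 0%N = r + m * q) /\ Y (r .: tl e))).
    apply: (bc_exists_in (Def_bool_class int_group)) => r _; apply: Def_and.
      by apply: (Def_cong group_refl); [exact: affine_var|exact: affine_const].
    apply: (Def_tl (P := fun a => Y (r .: a))); apply: IHn.
      by apply: Def_scons => //; apply: affine_const.
    by move=> a a' aa'; apply: dY => -[|i] //=; exact: aa'.
  apply: Def_iff D => e; split=> [[r [_ [er Yr]]]|Ye].
    by rewrite -(scons_eta e); apply: (proj1 (Ycong _ _ _ er)) Yr.
  have := divz_eq (e 0%N) m; have := modz_ge0 (e 0%N) (lt0r_neq0 m0).
  have := ltz_pmod (e 0%N) m0; move: (_ %/ _)%Z (_ %% _)%Z => q r rm r0 E.
  exists r; rewrite in_int_range; split; first by lia.
  split; first by exists q; lia.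
  by apply/(Ycong _ r (e 0%N)); [exists q; lia|rewrite scons_eta].
have DX' : Def S X' by apply/Def_not/(bc_equiv BC).
have dX' : depends n.+1 X'.
  move=> e e' ee'; rewrite /X'; have e'e i : (i < n.+1)%N -> e' i = e i by move/ee'.
  have XX : X e <-> X e' by split; apply: dX.
  have YY : Y e <-> Y e' by split; apply: dY.
  by rewrite XX YY.
have HX' a : periodic_between 1 m (values T a) (fun x => X' (x .: a)).
  by move=> x x' xx' H; rewrite /X' (HX a x x' xx' H) (Ycong a x x' xx').
have X'fin a x : X' (x .: a) -> (exists2 t, List.In t T & t a <= x) /\
    exists2 t, List.In t T & x < t a.
  suff: ((forall t, List.In t T -> x < t a) \/ (forall t, List.In t T -> t a <= x)) ->
      (X (x .: a) <-> Y (x .: a)).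
    move=> H nXY; split; apply: NNPP => none; apply: nXY; apply: H.
      by left=> t tT; rewrite ltNge; apply/negP => ?; apply: none; exists t.
    by right=> t tT; rewrite leNgt; apply/negP => ?; apply: none; exists t.
  have [N N0 HN] := list_bound (values T a).
  have up y y' : (forall t, List.In t T -> t a <= y) -> (forall t, List.In t T -> t a <= y') ->
      cong m y y' -> X (y .: a) <-> X (y' .: a).
    move=> yT y'T /(HX a); apply=> h /in_values[t tT <-].
    by have := yT t tT; have := y'T t tT; lia.
  have down y y' : (forall t, List.In t T -> y < t a) -> (forall t, List.In t T -> y' < t a) ->
      cong m y y' -> X (y .: a) <-> X (y' .: a).
    move=> yT y'T /(HX a); apply=> h /in_values[t tT <-].
    by have := yT t tT; have := y'T t tT; lia.
  have {}HN t : List.In t T -> `|t a| < N by move=> tT; apply: HN; apply/in_values; exists t.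
  have above y t : N <= y -> List.In t T -> t a <= y.
    by move=> yN /HN; lia.
  have below y t : y <= - N -> List.In t T -> y < t a.
    by move=> yN /HN; lia.
  have DXa : Def S (fun e => X (e 0%N .: a)).
    apply: (Def_subst group_sub (g := fun i e => if i is j.+1 then a j else e 0%N) DX) => -[|i].
      exact: affine_var.
    exact: affine_const.
  have agree y y' : (forall t, List.In t T -> t a <= y) -> (forall t, List.In t T -> y' < t a) ->
      cong m y y' -> X (y .: a) <-> X (y' .: a).
    move=> yT y'T [q E].
    have big (u : int) : N <= u + m * (`|u| + N) by nia.
    have small (u : int) : u - m * (`|u| + N) <= - N by nia.
    rewrite (up y (y + m * (`|y| + N))) //; last by exists (`|y| + N).
      rewrite (down y' (y' - m * (`|y'| + N))) //; last by exists (- (`|y'| + N)); lia.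
        apply: (ends_agree (U := fun y => X (y .: a)) m0 DXa (N := N)) => //
          [u u' uN u'N|u u' uN u'N|].
        - by apply: up => t tT; apply: above.
        - by apply: down => t tT; apply: below.
        - by exists (q - (`|y| + N) - (`|y'| + N)); rewrite E; lia.
      by move=> t tT; apply: below.
    by move=> t tT; apply: above.
  have aboveY y : (forall t, List.In t T -> t a <= y) -> X (y .: a) <-> Y (y .: a).
    move=> yT; split=> [Xy z|Yy].
      have Xup r : 0 <= r -> X (y + m * r .: a).
        move=> r0; apply: (proj1 (up y _ yT _ _)) Xy; last by exists r.
        by move=> t tT; have := yT t tT; nia.
      case: (leP 0 z) => z0.
        by exists 0; rewrite /tl /= mulr0 addr0 -{1}[y]addr0 -{1}(mulr0 m); split; apply: Xup.
      exists (- z); rewrite /tl /=; split; first by apply: Xup; lia.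
      suff -> : y + m * - z + m * z = y + m * 0 by apply: Xup.
      by lia.
    apply: NNPP => nXy.
    have Xmid w : cong m y w -> X (w .: a) -> - N < w < N.
      move=> yw Xw; apply/andP; split; rewrite ltNge; apply/negP => wN; apply: nXy.
        by apply/(agree y w yT) => // t tT; apply: below.
      by apply/(up y w yT) => // t tT; apply: above.
    (* Two points of ]- N, N[ cannot differ by as much as 2 * N * m. *)
    have [q [/= Xw Xw']] := Yy (2 * N).
    have wN : - N < y + m * q < N by apply: Xmid Xw; exists q.
    have w'N : - N < y + m * q + m * (2 * N) < N.
      by apply: Xmid Xw'; exists (q + 2 * N); lia.
    by nia.
  case=> [xT|]; last exact: aboveY.
  pose x1 := x + m * (`|x| + N).
  have x1T t : List.In t T -> t a <= x1 by apply: above; rewrite /x1; nia.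
  have xx1 : cong m x x1 by exists (`|x| + N).
  have x1x : cong m x1 x by exists (- (`|x| + N)); rewrite /x1; lia.
  by rewrite -(agree x1 x x1T xT x1x) aboveY // (Ycong a x x1 xx1).
have [C HC] := fibers_near_lines m0 AT DX' HX' X'fin.
have GX' := Def_group_near_lines DX' dX' AT dT HC.
apply: Def_iff (Def_not (bc_equiv (Def_bool_class int_group) GX' GY)) => e.
rewrite /X'; case: (classic (X e)); case: (classic (Y e)); tauto.
Qed.

End Induction.

(** Replacing the eliminated coordinate x by [k * x] makes its coefficient 1 in all the
    thresholds; [P'] is the image of [P] under this rescaling. *)
Lemma Def_group_of_Def n P : Def S P -> depends n P -> Def int_group P.
Proof.
elim: n P => [|n IH] P DP dP.
  apply: Def_iff (bc_const (Def_bool_class int_group) (P (fun _ => 0))) => e.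
  by split; apply: dP.
have [k [m [T [k0 m0 AT HT]]]] := presburger_fibers (sub_presburger DP).
pose P' e := exists x, k * x = e 0%N /\ P (x .: tl e).
have DP' : Def S P'.
  apply: (Def_ex (P := fun e => k * e 0%N = e 1%N /\ P (e 0%N .: tl (tl e)))).
  apply: Def_and; first by apply: Def_eq (affine_var 1) => //; apply/affine_scale/affine_var.
  apply: (Def_subst group_sub (g := fun i e => if i is j.+1 then e j.+2 else e 0%N) DP) => -[|i];
  exact: affine_var.
have dP' : depends n.+1 P'.
  move=> e e' ee' [x [kx Px]]; exists x; rewrite -ee' //; split=> //.
  by apply: dP Px => -[|i] //= ltin; rewrite /tl ee'.
have GP' : Def int_group P'.
  apply: (Def_group_fibered IH (m := k * m) _ AT DP' dP'); first by rewrite mulr_gt0.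
  have half a z z' : cong (k * m) z z' ->
     (forall h, List.In h (values T a) -> 1 * z < h <-> 1 * z' < h) ->
     P' (z .: a) -> P' (z' .: a).
    move=> [q E] H [x [/= kx Px]]; exists (x + m * q); split; first by rewrite /= E; lia.
    apply: (proj1 (HT a x (x + m * q) _ _) Px); first by exists q.
    by move=> h /H; rewrite !mul1r E -kx mulrDr mulrA.
  move=> a z z' zz' H; split; first exact: half.
  apply: half => [|h hT]; last by rewrite H.
  by case: zz' => q ->; exists (- q); lia.
have D : Def int_group (fun e => P' (k * e 0%N .: tl e)).
  apply: (Def_subst group_refl (g := fun i e => if i is j.+1 then e j.+1
    else k * e 0%N) GP') => -[|i].
    by apply/affine_scale/affine_var.
  exact: affine_var.
apply: Def_iff D => e; split=> [[x [/= kx]]|Pe].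
  by rewrite (mulfI (lt0r_neq0 k0) kx) scons_eta.
by exists (e 0%N); rewrite scons_eta.
Qed.

End Intermediate.

Theorem theorem1p1 (L : language) (S : structure L int) :
  expansion S int_group ->
  reduct S int_ordered_group ->
  interdefinable S int_group \/ interdefinable S int_ordered_group.
Proof.
move=> redG redO; have group_sub P := @Def_reduct _ _ _ _ P redG.
have sub_presburger P (DP : Def S P) := Def_ordered_group_presburger (Def_reduct redO DP).
case: (classic (Def S (fun e => e 0%N < e 1%N))) => [order|no_order]; [right|left].
- by split=> //; apply: reduct_Def => P /Def_ordered_group_presburger; apply: Def_presburger.
- split=> //; apply: reduct_Def => P DP; have [n dP] := Def_depends DP.
  exact: (Def_group_of_Def group_sub sub_presburger no_order DP dP).
Qed.
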